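(* Let $G$ be a connected graph of order $n$. Then $\mathrm{fxd}(G)=n-1$ if and only if there exist distinct vertices $u,v\in V(G)$ with $N(v)\setminus\{u\}=N(u)\setminus\{v\}$.
   Context: Graphs are finite and simple and (standing assumption) have nontrivial automorphism group $\mathrm{Aut}(G)$. $N(v)$ is the set of neighbours of $v$. For $S\subseteq V(G)$, $\mathrm{stab}(S)=\{g\in \mathrm{Aut}(G): g(v)=v \text{ for all } v\in S\}$; $S$ is a fixing set if $\mathrm{stab}(S)$ is trivial. $\mathrm{fxd}(G)$ is the minimum $k$ such that every $k$-element subset of $V(G)$ is a fixing set of $G$. *)

(* Defs.v *)
From mathcomp Require Import all_boot all_fingroup.

Set Implicit Arguments.
Unset Strict Implicit.
Unset Printing Implicit Defensive.

(* A finite simple graph is a symmetric irreflexive relation on a finType; the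
   notions below do not use these two properties, which are hypotheses of the
   theorems about them. *)
Section Graph.
Variables (T : finType) (e : rel T).

Definition connected_graph := forall x y : T, connect e x y.

Definition neighbours (v : T) : {set T} := [set w | e v w].

Definition graph_aut : {set {perm T}} :=
  [set g : {perm T} | [forall x, forall y, e (g x) (g y) == e x y]].

Lemma graph_aut_group_set : group_set graph_aut.
Proof.
apply/group_setP; split=> [|g h].
  by rewrite inE; apply/forallP=> x; apply/forallP=> y; rewrite !perm1.
rewrite !inE => /forallP Hg /forallP Hh.
apply/forallP=> x; apply/forallP=> y; rewrite !permM.
by rewrite (eqP (forallP (Hh _) _)) (eqP (forallP (Hg _) _)).
Qed.

Canonical graph_aut_group := Group graph_aut_group_set.

Definition stab (S : {set T}) : {set {perm T}} := 'C_graph_aut(S | 'P)%g.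

Lemma stabP (S : {set T}) (g : {perm T}) :
  reflect (g \in graph_aut /\ {in S, forall v, g v = v}) (g \in stab S).
Proof.
rewrite /stab in_setI; apply: (iffP andP) => -[Ag Sg]; split=> //.
  by move=> v Sv; have := astab_act Sg Sv.
by apply/astabP=> v Sv; apply: Sg.
Qed.

Definition fixing_set (S : {set T}) : bool := stab S == 1%g.

Definition all_fixing (k : nat) : bool :=
  [forall S : {set T}, (#|S| == k) ==> fixing_set S].

Lemma all_fixing_ex : exists k, all_fixing k.
Proof.
exists #|T|; apply/forallP=> S; apply/implyP=> /eqP cardS.
have ST : S = setT by apply/eqP; rewrite eqEcard subsetT cardsT cardS /=.
rewrite /fixing_set ST; apply/eqP/setP=> g; rewrite [RHS]inE.
apply/stabP/eqP=> [[_ gfix]|->].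
  by apply/permP=> v; rewrite perm1 gfix ?inE.
by split=> [|v _]; rewrite ?perm1 // (group1 graph_aut_group).
Qed.

Definition fxd : nat := ex_minn all_fixing_ex.

End Graph.

(* Main.v *)
(** A set of size [n - 1] is always fixing, and a nontrivial automorphism
    fixing all vertices but two must be the transposition of these two; the
    transposition of [u] and [v] is an automorphism exactly when [u] and [v]
    are twins.  In that case no set avoiding both [u] and [v] is fixing, and
    such sets exist in every size up to [n - 2]. *)
Require Import Defs.
From mathcomp Require Import all_boot all_fingroup.

Definition twins (T : finType) (e : rel T) (u v : T) :=
  neighbours e v :\ u = neighbours e u :\ v.

Lemma twinsP (T : finType) (e : rel T) (u v : T) (irr : irreflexive e) :
  twins T e u v <-> (forall w, w != u -> w != v -> e u w = e v w).
Proof.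
split=> [tw w wu wv|tw].
  by move/setP/(_ w): tw; rewrite !inE wu wv.
apply/setP=> w; rewrite !inE.
(* At [w = u] and at [w = v] one side drops [w] explicitly and the other lacks it because there are
   no loops. *)
have [->|wu] := eqVneq w u; first by rewrite irr andbF.
have [->|wv] := eqVneq w v; first by rewrite irr.
by rewrite /= tw.
Qed.

Lemma stab_perm_on (T : finType) (e : rel T) (S : {set T}) (g : {perm T}) :
  g \in stab e S -> perm_on (~: S) g.
Proof.
case/stabP=> _ gS; apply/subsetP=> x; rewrite !inE.
by apply: contraNN => /gS ->.
Qed.

(** If [g] fixed [u], it could move at most the single point [v], hence nothing; so [g] must swap
    the two points. *)
Lemma perm_on_set2 (T : finType) (u v : T) (g : {perm T}) :
  perm_on [set u; v] g -> g <> 1%g -> g = tperm u v.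
Proof.
move=> gon g_neq1.
have [gu|gu] := eqVneq (g u) u.
  case: g_neq1; apply: (@perm_on_id _ _ [set v]); last by rewrite cards1.
  apply/subsetP=> x gx; have := subsetP gon x gx; rewrite !inE.
  by case/orP=> // /eqP xu; move: gx; rewrite inE xu gu eqxx.
have guv : g u = v.
  have : g u \in [set u; v] by rewrite (perm_closed _ gon) !inE eqxx.
  by rewrite !inE (negbTE gu) => /eqP.
have gvu : g v = u.
  have : g v \in [set u; v] by rewrite (perm_closed _ gon) !inE eqxx orbT.
  rewrite !inE => /orP[/eqP //|/eqP gv].
  (* Applying the injective [g] to both sides of [g u != u] gives [g v != v]. *)
  by move: gu; rewrite -(inj_eq (@perm_inj _ g)) guv gv eqxx.
apply/permP=> x; case: tpermP => [->|->|/eqP xu /eqP xv] //.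
by apply: (out_perm gon); rewrite !inE negb_or xu xv.
Qed.

Lemma tperm_graph_aut (T : finType) (e : rel T) (u v : T)
    (sym : symmetric e) (irr : irreflexive e) :
  u <> v -> tperm u v \in graph_aut e <-> twins T e u v.
Proof.
move=> uv; split=> [|/(twinsP _ _ _ _ irr) tw].
  rewrite inE => /forallP aut; apply/(twinsP _ _ _ _ irr) => w wu wv.
  have /forallP/(_ w)/eqP := aut u.
  by rewrite tpermL tpermD 1?eq_sym.
rewrite inE; apply/forallP=> x; apply/forallP=> y; apply/eqP.
(* Of the nine positions of [x] and [y], irreflexivity settles equal endpoints, symmetry the pair
   [u], [v], and the twin condition those with exactly one endpoint in [{u, v}]. *)
case: (tpermP u v x) => [->|->|/eqP xu /eqP xv];
  case: (tpermP u v y) => [->|->|/eqP yu /eqP yv];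
  by [rewrite ?irr | rewrite sym | rewrite tw | rewrite [LHS]sym [RHS]sym tw].
Qed.

Lemma exists_subset_card (T : finType) (A : {set T}) (k : nat) :
  k <= #|A| -> exists2 S : {set T}, S \subset A & #|S| = k.
Proof.
move=> kA; exists [set x in take k (enum A)].
  by apply/subsetP=> x; rewrite inE => /mem_take; rewrite mem_enum.
rewrite cardsE (card_uniqP _) ?take_uniq ?enum_uniq //.
by rewrite size_takel // -cardE.
Qed.

(** At most one vertex lies outside such a set, and no permutation moves exactly one point. *)
Lemma all_fixing_pred_card (T : finType) (e : rel T) :
  all_fixing e (#|T| - 1).
Proof.
apply/forallP=> S; apply/implyP=> /eqP cardS; apply/eqP/trivgP.
apply/subsetP=> g /stab_perm_on gon; rewrite inE; apply/eqP.
by apply: perm_on_id gon _; rewrite cardsCs setCK cardS leq_subLR addnC -leq_subLR.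
Qed.

(** Covering every [k] up to [#|T| - 2] lets this apply directly to the minimum that defines
    [fxd]. *)
Lemma not_all_fixing_twins (T : finType) (e : rel T) (u v : T) (k : nat)
    (sym : symmetric e) (irr : irreflexive e) :
  u <> v -> twins T e u v -> k <= #|T| - 2 -> ~~ all_fixing e k.
Proof.
move=> uv tw kT; have uv' : u != v by apply/eqP.
have [|S sS cardS] := @exists_subset_card T (~: [set u; v]) k.
  by rewrite cardsCs setCK cards2 uv'.
apply/forallPn; exists S; rewrite negb_imply cardS eqxx /=.
apply/negP=> /eqP stab1.
have : tperm u v \in stab e S.
  apply/stabP; split; first exact/tperm_graph_aut.
  move=> w /(subsetP sS); rewrite !inE negb_or => /andP[wu wv].
  by rewrite tpermD // eq_sym.
rewrite stab1 inE => /eqP/permP/(_ u); rewrite tpermL perm1.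
by move=> vu; case: uv.
Qed.

Lemma not_all_fixing_exists_twins (T : finType) (e : rel T)
    (sym : symmetric e) (irr : irreflexive e) :
  1 < #|T| -> ~~ all_fixing e (#|T| - 2) ->
  exists u v : T, u <> v /\ twins T e u v.
Proof.
move=> T_gt1 /forallPn[S]; rewrite negb_imply => /andP[/eqP cardS].
rewrite /fixing_set -subG1 => /subsetPn[g gS]; rewrite inE => /eqP g_neq1.
(* [1 < #|T|] keeps the subtraction from truncating, so exactly two vertices lie outside [S]. *)
have /cards2P[u [v [uv CS]]] : #|~: S| == 2 by rewrite cardsCs setCK cardS subKn.
have /eqP uv' := uv; exists u, v; split=> //.
apply/(tperm_graph_aut _ _ _ _ sym irr uv').
have := stab_perm_on _ _ _ _ gS; rewrite CS => /perm_on_set2 <- //.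
by case/stabP: gS.
Qed.

Theorem theorem2 (T : finType) (e : rel T) (n : nat)
  (e_sym : symmetric e) (e_irr : irreflexive e)
  (aut_nontrivial : graph_aut e <> 1%g)
  (e_conn : connected_graph e) (order_n : #|T| = n) :
  fxd e = n - 1 <->
  exists u v : T, u <> v /\ neighbours e v :\ u = neighbours e u :\ v.
Proof.
subst n; rewrite /fxd; case: ex_minnP => m fix_m min_m; split=> [m_eq|].
  (* With at most one vertex the identity would be the only permutation. *)
  have T_gt1 : 1 < #|T|.
    rewrite ltnNge; apply/negP=> T_le1; apply: aut_nontrivial.
    apply/trivgP/subsetP=> g _; rewrite inE; apply/eqP.
    apply: (@perm_on_id _ _ setT); last by rewrite cardsT.
    by apply/subsetP=> x; rewrite !inE.
  (* If all sets of size [#|T| - 2] were fixing, the minimum would be below [#|T| - 1]. *)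
  apply: not_all_fixing_exists_twins => //; apply/negP=> /min_m.
  by rewrite m_eq leqNgt ltn_sub2l.
case=> u [v [uv tw]]; apply/eqP; rewrite eqn_leq min_m ?all_fixing_pred_card //=.
rewrite leqNgt; apply/negP=> m_lt.
apply/negP: fix_m; apply: not_all_fixing_twins uv tw _ => //.
by move: m_lt; rewrite subn1 subn2; case: #|T|.-1.
Qed.
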